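(* Let $R$ be a commutative ring with unit containing $\mathbb{Q}$, $n\ge 1$, and let $G=(G_i)_{1\le i\le n}$ be a system of formal power series with coefficients in $R$ in $n$ indeterminates $u=(u_1,\ldots,u_n)$. Let $F=(F_i)_{1\le i\le n}$ be the system of formal power series in $R[[X]]=R[[X_1,\ldots,X_n]]$, without constant term, implicitly defined by $F_i=X_iG_i(F)$ for $1\le i\le n$. For any monomial $\Omega(u)=u_1^{\alpha_1}\cdots u_n^{\alpha_n}$, so that $\Omega(F)=F_1^{\alpha_1}\cdots F_n^{\alpha_n}$, the following identity holds in $R[[X]]$, both sides being well-defined: $$\Omega(F)\times\frac{1}{\det\left(I-X\partial G(F)\right)}=\int d\bar u\,du\ e^{-\bar uu}\ \Omega(u)\,e^{\bar uXG(u)},$$ the right-hand side being the formal Gaussian integral with identity covariance.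
   Context: $I$ is the $n\times n$ identity matrix and $X\partial G(F)$ is the $n\times n$ matrix over $R[[X]]$ with entries $[X\partial G(F)]_{ij}=X_i\,\partial_jG_i(F)$, where $\partial_jG_i(F)$ is the result of substituting $F=F(X)$ for $u$ in $\frac{\partial G_i}{\partial u_j}(u)$. $\bar u=(\bar u_1,\ldots,\bar u_n)$ and $u$ are vectors of indeterminates and $\bar uXG(u)=\sum_{i=1}^n\bar u_iX_iG_i(u)$. Formal Gaussian integral with identity covariance: write $[k]=\{1,\ldots,k\}$. For $\beta_1,\beta_2\in\mathbb N^n$, $\int d\bar u\,du\ e^{-\bar uu}\ \bar u^{\beta_1}u^{\beta_2}=\sum_\sigma\prod_{k=1}^{k_1}\delta_{\tau_2(\sigma(k))\,\tau_1(k)}$, where $k_r=|\beta_r|$, $\tau_r:[k_r]\to[n]$ is any map taking each value $i$ exactly $(\beta_r)_i$ times, $\delta$ is Kronecker's symbol, and the sum is over all bijections $\sigma:[k_1]\to[k_2]$ (zero if $k_1\neq k_2$). For $U\in R[[\bar u,u,X]]$ the integral is the sum, over all monomials $\bar u^{\beta_1}u^{\beta_2}X^{\beta_3}$, of the coefficient of the monomial in $U$ times $X^{\beta_3}$ times the integral of $\bar u^{\beta_1}u^{\beta_2}$, an element of $R[[X]]$, defined whenever for each $\beta_3$ only finitely many $(\beta_1,\beta_2)$ contribute nonzero terms. *)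

(* Defs.v *)
From HB Require Import structures.
From mathcomp Require Import all_boot all_order all_algebra.
From mathcomp Require Import boolp classical_sets cardinality fsbigop.
From mathcomp Require Import mpoly.

Set Implicit Arguments.
Unset Strict Implicit.
Unset Printing Implicit Defensive.

Import GRing.Theory.
Local Open Scope ring_scope.
Local Open Scope classical_set_scope.

(* R[[X_1, ..., X_n]]; the coercion to functions gives the coefficients. *)
Record mfps (R : Type) (n : nat) := MFps { mfps_coef :> 'X_{1..n} -> R }.

Notation "{ 'mfps' R [ n ] }" := (mfps R n)
  (at level 0, R at level 2, n at level 2, format "{ 'mfps'  R [ n ] }")
  : type_scope.

Lemma mfpsP (R : Type) n (f g : {mfps R[n]}) : f =1 g -> f = g.
Proof. by case: f g => f [g] /= /funext ->. Qed.

HB.instance Definition _ (R : Type) n := gen_eqMixin {mfps R[n]}.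
HB.instance Definition _ (R : Type) n := gen_choiceMixin {mfps R[n]}.

Section Ring.
Context (R : comNzRingType) (n : nat).
Implicit Types (f g h : {mfps R[n]}) (m : 'X_{1..n}) (c : R).

Definition mfps_zero : {mfps R[n]} := MFps (fun=> 0).
Definition mfps_opp f : {mfps R[n]} := MFps (fun m => - f m).
Definition mfps_add f g : {mfps R[n]} := MFps (fun m => f m + g m).
Definition mfps_scale c f : {mfps R[n]} := MFps (fun m => c * f m).

(* X^m *)
Definition mfps_mono m : {mfps R[n]} := MFps (fun k => (k == m)%:R).

(* Same convolution as [mcoeffM]; the degree bounds only make the index type
   finite. *)
Definition mfps_mul f g : {mfps R[n]} := MFps (fun m =>
  \sum_(k : 'X_{1..n < (mdeg m).+1, (mdeg m).+1} | m == (k.1 + k.2)%MM)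
    f k.1 * g k.2).

Fact mfps_addA : associative mfps_add.
Proof. by move=> f g h; apply: mfpsP => m /=; rewrite addrA. Qed.
Fact mfps_addC : commutative mfps_add.
Proof. by move=> f g; apply: mfpsP => m /=; rewrite addrC. Qed.
Fact mfps_add0 : left_id mfps_zero mfps_add.
Proof. by move=> f; apply: mfpsP => m /=; rewrite add0r. Qed.
Fact mfps_addN : left_inverse mfps_zero mfps_opp mfps_add.
Proof. by move=> f; apply: mfpsP => m /=; rewrite addNr. Qed.

HB.instance Definition _ := GRing.isZmodule.Build {mfps R[n]}
  mfps_addA mfps_addC mfps_add0 mfps_addN.

Let trunc d f : {mpoly R[n]} := \sum_(k : 'X_{1..n < d}) f k *: 'X_[k].

Let truncE d f m : (mdeg m < d)%N -> (trunc d f)@_m = f m.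
Proof. by move=> lt_md; rewrite mcoeff_mpoly. Qed.

Let mulE f g (p q : {mpoly R[n]}) m :
    (forall k, (mdeg k <= mdeg m)%N -> f k = p@_k) ->
    (forall k, (mdeg k <= mdeg m)%N -> g k = q@_k) ->
  mfps_mul f g m = (p * q)@_m.
Proof.
move=> fp gq; rewrite mcoeffM; apply: eq_bigr => k _.
by rewrite fp ?gq // -ltnS bmdeg.
Qed.

Let mulT d f g m : (mdeg m < d)%N ->
  mfps_mul f g m = (trunc d f * trunc d g)@_m.
Proof.
move=> lt_md; apply: mulE => k le_km; rewrite truncE //;
exact: leq_ltn_trans lt_md.
Qed.

Fact mfps_mulA : associative mfps_mul.
Proof.
move=> f g h; apply: mfpsP => m; set d := (mdeg m).+1.
rewrite (@mulE f _ (trunc d f) (trunc d g * trunc d h)); first last.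
- by move=> k le_km; apply: mulT.
- by move=> k le_km; rewrite truncE.
rewrite (@mulE _ h (trunc d f * trunc d g) (trunc d h)) ?mulrA //.
- by move=> k le_km; apply: mulT.
- by move=> k le_km; rewrite truncE.
Qed.

Fact mfps_mulC : commutative mfps_mul.
Proof. by move=> f g; apply: mfpsP => m; rewrite !(mulT _ _ (ltnSn _)) mulrC. Qed.

Fact mfps_mul1 : left_id (mfps_mono 0%MM) mfps_mul.
Proof.
move=> f; apply: mfpsP => m.
rewrite (@mulE _ _ 1 (trunc (mdeg m).+1 f)) ?mul1r ?truncE //.
- by move=> k _; rewrite mcoeff1.
- by move=> k le_km; rewrite truncE.
Qed.

Fact mfps_mulDl : left_distributive mfps_mul mfps_add.
Proof.
move=> f g h; apply: mfpsP => m /=; rewrite -big_split /=.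
by apply: eq_bigr => k _; rewrite mulrDl.
Qed.

Fact mfps_one_neq0 : mfps_mono 0%MM != mfps_zero.
Proof.
apply/eqP => /(congr1 (fun f : {mfps R[n]} => f 0%MM)) /= /eqP.
by rewrite eqxx oner_eq0.
Qed.

HB.instance Definition _ := GRing.Zmodule_isComNzRing.Build {mfps R[n]}
  mfps_mulA mfps_mulC mfps_mul1 mfps_mulDl mfps_one_neq0.

Fact mfps_scaleA c c' f :
  mfps_scale c (mfps_scale c' f) = mfps_scale (c * c') f.
Proof. by apply: mfpsP => m /=; rewrite mulrA. Qed.
Fact mfps_scale1 : left_id 1 mfps_scale.
Proof. by move=> f; apply: mfpsP => m /=; rewrite mul1r. Qed.
Fact mfps_scaleDr : right_distributive mfps_scale +%R.
Proof. by move=> c f g; apply: mfpsP => m /=; rewrite mulrDr. Qed.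
Fact mfps_scaleDl f : {morph mfps_scale^~ f : c c' / c + c'}.
Proof. by move=> c c'; apply: mfpsP => m /=; rewrite mulrDl. Qed.

HB.instance Definition _ := GRing.Zmodule_isLmodule.Build R {mfps R[n]}
  mfps_scaleA mfps_scale1 mfps_scaleDr mfps_scaleDl.

(* R is not assumed to have decidable units, so the units of R[[X]] and their
   inverses are obtained classically. *)
Definition mfps_unit : {pred {mfps R[n]}} :=
  fun f => `[< exists g : {mfps R[n]}, g * f = 1 >].

Definition mfps_inv f : {mfps R[n]} :=
  if pselect (exists g : {mfps R[n]}, g * f = 1) is left ex_g
  then projT1 (cid ex_g) else f.

Fact mfps_mulV : {in mfps_unit, left_inverse 1 mfps_inv *%R}.
Proof.
move=> f /asboolP uf; rewrite /mfps_inv.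
by case: pselect => // ex_g; case: cid.
Qed.

Fact mfps_unitP f g : g * f = 1 -> mfps_unit f.
Proof. by move=> gf1; apply/asboolP; exists g. Qed.

Fact mfps_inv_out : {in [predC mfps_unit], mfps_inv =1 id}.
Proof.
move=> f; rewrite inE /= => /asboolP nuf; rewrite /mfps_inv.
by case: pselect.
Qed.

HB.instance Definition _ := GRing.ComNzRing_hasMulInverse.Build {mfps R[n]}
  mfps_mulV mfps_unitP mfps_inv_out.

Definition mfps_X (i : 'I_n) : {mfps R[n]} := mfps_mono U_(i)%MM.

Definition mfps_deriv (j : 'I_n) f : {mfps R[n]} :=
  MFps (fun m => f (m + U_(j))%MM *+ (m j).+1).

End Ring.

Section Sum.
Context (R : comNzRingType) (n : nat).

Definition mfps_summable (T : choiceType) (f : T -> {mfps R[n]}) :=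
  forall m, finite_set [set t | f t m <> 0].

(* Formal sum of a locally finite family; only meaningful for a summable one,
   since \sum_(t \in A) is 0 on an infinite support. *)
Definition mfps_sum (T : choiceType) (f : T -> {mfps R[n]}) : {mfps R[n]} :=
  MFps (fun m => \sum_(t \in setT) f t m).

(* Substitution g(F_1, ..., F_p); meaningful as soon as the F_i have no
   constant term (see mfps_comp_summable). *)
Definition mfps_comp_term p (g : {mfps R[p]}) (F : 'I_p -> {mfps R[n]})
    (k : 'X_{1..p}) : {mfps R[n]} :=
  g k *: \prod_(i < p) F i ^+ k i.

Definition mfps_comp p (g : {mfps R[p]}) (F : 'I_p -> {mfps R[n]}) :=
  mfps_sum (mfps_comp_term g F).

End Sum.

Definition mfps_exp_term (R : comAlgType rat) n (f : {mfps R[n]}) (k : nat)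
  : {mfps R[n]} := ((k`!%:R^-1 : rat)%:A : R) *: f ^+ k.

Definition mfps_exp (R : comAlgType rat) n (f : {mfps R[n]}) : {mfps R[n]} :=
  mfps_sum (mfps_exp_term f).

Section Truncation.
Context (R : comNzRingType) (n : nat).
Implicit Types (f g : {mfps R[n]}) (F H : 'I_n -> {mfps R[n]}).

(* f = g modulo terms of total degree at least d *)
Definition mfps_eqmod d f g := forall m, (mdeg m < d)%N -> f m = g m.

Lemma mfps_coefM f g m : (f * g) m =
  \sum_(k : 'X_{1..n < (mdeg m).+1, (mdeg m).+1} | m == (k.1 + k.2)%MM)
    f k.1 * g k.2.
Proof. by []. Qed.

Lemma mfps_coef_sum I (r : seq I) (P : pred I) (f : I -> {mfps R[n]}) m :
  (\sum_(i <- r | P i) f i) m = \sum_(i <- r | P i) f i m.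
Proof.
by apply: (big_morph (fun g : {mfps R[n]} => g m) (op1 := +%R) (id1 := 0)).
Qed.

Lemma mfps_eqmodM d f f' g g' : mfps_eqmod d f f' -> mfps_eqmod d g g' ->
  mfps_eqmod d (f * g) (f' * g').
Proof.
move=> ff' gg' m lt_md; rewrite !mfps_coefM; apply: eq_bigr => k _.
by rewrite ff' ?gg' //; apply: leq_trans (bmdeg _) _.
Qed.

Lemma mfps_eqmodX d f f' k : mfps_eqmod d f f' ->
  mfps_eqmod d (f ^+ k) (f' ^+ k).
Proof.
by move=> ff'; elim: k => [|k IH] //; rewrite !exprS; apply: mfps_eqmodM.
Qed.

Lemma mfps_eqmod_comp p d (g : {mfps R[p]}) (F H : 'I_p -> {mfps R[n]}) :
  (forall i, mfps_eqmod d (F i) (H i)) ->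
  mfps_eqmod d (mfps_comp g F) (mfps_comp g H).
Proof.
move=> FH m lt_md; apply: eq_fsbigr => k _; congr (_ * _).
suff: mfps_eqmod d (\prod_i F i ^+ k i) (\prod_i H i ^+ k i) by apply.
elim/big_rec2: _ => // i f f' _ IH.
by apply: mfps_eqmodM => //; apply: mfps_eqmodX.
Qed.

Lemma mfps_eqmod_X d i f g : mfps_eqmod d f g ->
  mfps_eqmod d.+1 (mfps_X R i * f) (mfps_X R i * g).
Proof.
move=> fg m lt_md; rewrite !mfps_coefM; apply: eq_bigr => k /eqP Dm /=.
have [k1E|] := eqVneq (k.1 : 'X_{1..n}) U_(i)%MM; last by rewrite !mul0r.
have := congr1 mdeg Dm; rewrite mdegD k1E mdeg1 add1n => Ed.
by rewrite fg // -ltnS -Ed.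
Qed.

Lemma mfps_prod_low d1 d2 f g :
  (forall m, (mdeg m < d1)%N -> f m = 0) ->
  (forall m, (mdeg m < d2)%N -> g m = 0) ->
  forall m, (mdeg m < d1 + d2)%N -> (f * g) m = 0.
Proof.
move=> f0 g0 m lt_md; rewrite mfps_coefM big1 // => k /eqP Dm.
have [/f0->|le1] := ltnP (mdeg k.1) d1; first by rewrite mul0r.
have [/g0->|le2] := ltnP (mdeg k.2) d2; first by rewrite mulr0.
by move: (leq_add le1 le2); rewrite -mdegD -Dm leqNgt lt_md.
Qed.

Lemma mfps_exp_low f k : f 0%MM = 0 ->
  forall m, (mdeg m < k)%N -> (f ^+ k) m = 0.
Proof.
move=> f0; elim: k => // k IH; rewrite exprS -add1n => m.
apply: (mfps_prod_low (d1 := 1) _ IH) => {}m.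
by rewrite ltnS leqn0 mdeg_eq0 => /eqP->.
Qed.

Lemma mfps_comp_summable p (g : {mfps R[p]}) (F : 'I_p -> {mfps R[n]}) :
  (forall i, F i 0%MM = 0) -> mfps_summable (mfps_comp_term g F).
Proof.
move=> F0 m; pose s := [seq val k | k <- enum {: 'X_{1..p < (mdeg m).+1}}].
apply: sub_finite_set (finite_seq s) => k /= nz; apply: contrapT => /negP ks.
apply: nz; rewrite /mfps_comp_term /= [X in _ * X](_ : _ = 0) ?mulr0 //.
have: (mdeg m < mdeg k)%N.
  rewrite ltnNge; apply: contra ks; rewrite -ltnS => lt_km.
  by apply/mapP; exists (BMultinom lt_km); rewrite ?mem_enum.
rewrite (mdegE k); move: m {s ks}.
elim: (index_enum _) => [|i r IH] m.
  by rewrite !big_nil.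
rewrite !big_cons.
move: m; apply: mfps_prod_low IH; exact: mfps_exp_low.
Qed.

(* F_i = X_i G_i(F) has exactly one solution; the absence of constant terms is
   automatic because of the factor X_i. *)
Lemma mfps_implicit_unique G F H :
    (forall i, F i = mfps_X R i * mfps_comp (G i) F) ->
    (forall i, H i = mfps_X R i * mfps_comp (G i) H) ->
  forall i, F i = H i.
Proof.
move=> FE HE i.
suff FH d : forall i, mfps_eqmod d (F i) (H i).
  by apply: mfpsP => m; apply: FH (ltnSn _).
elim: d => [|d IH] {}i; first by [].
by rewrite FE HE; apply/mfps_eqmod_X/mfps_eqmod_comp.
Qed.

Lemma mfps_implicit_ex (G : 'I_n -> {mfps R[n]}) :
  exists F : 'I_n -> {mfps R[n]}, (forall i, F i 0%MM = 0) /\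
    (forall i, F i = mfps_X R i * mfps_comp (G i) F).
Proof.
pose step F i := mfps_X R i * mfps_comp (G i) F.
pose it k := iter k step (fun=> 0).
have itS k : forall i, mfps_eqmod k (it k i) (it k.+1 i).
  elim: k => [|k IH] i; first by [].
  exact/mfps_eqmod_X/mfps_eqmod_comp.
have itD k j i : mfps_eqmod k (it k i) (it (k + j)%N i).
  elim: j => [|j IH] m lt_mk; first by rewrite addn0.
  by rewrite IH // addnS; apply: itS; apply: leq_trans lt_mk (leq_addr _ _).
pose F i : {mfps R[n]} := MFps (fun m => it (mdeg m).+1 i m).
have Fit k i : mfps_eqmod k (F i) (it k i).
  by move=> m lt_mk; rewrite -(subnKC lt_mk) -itD.
have FE i : F i = step F i.
  apply: mfpsP => m; apply/esym.
  have: mfps_eqmod (mdeg m).+1 (step F i) (it (mdeg m).+1 i).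
    by apply: mfps_eqmod_X; apply: mfps_eqmod_comp => j; apply: Fit.
  by apply.
exists F; split=> // i; rewrite FE.
rewrite /step mfps_coefM big1 // => k /eqP /esym/eqP; rewrite mnmD_eq0.
by case/andP=> /eqP-> _; rewrite /= eq_sym mnm1_eq0 mul0r.
Qed.

End Truncation.

Lemma mfps_exp_summable (R : comAlgType rat) n (f : {mfps R[n]}) :
  f 0%MM = 0 -> mfps_summable (mfps_exp_term f).
Proof.
move=> f0 m; apply: sub_finite_set (finite_seq (iota 0 (mdeg m).+1)) => k /= nz.
suff: k \in iota 0 (mdeg m).+1 by [].
rewrite mem_iota /= add0n ltnS leqNgt; apply/negP => lt_mk; apply: nz.
by rewrite /mfps_exp_term /= mfps_exp_low ?mulr0.
Qed.

Definition XdG (R : comNzRingType) n (G F : 'I_n -> {mfps R[n]})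
  : 'M[{mfps R[n]}]_n :=
  \matrix_(i, j) (mfps_X R i * mfps_comp (mfps_deriv j (G i)) F).

(* In R[[ubar, u, X]] the 3n indeterminates are numbered in this order. *)
Section Variables3.
Context (R : comNzRingType) (n : nat).

Definition mnm3 (b1 b2 b3 : 'X_{1..n}) : 'X_{1..n + (n + n)} :=
  [multinom of cat_tuple b1 (cat_tuple b2 b3)].

Definition var_ubar (i : 'I_n) : {mfps R[n + (n + n)]} :=
  mfps_X R (lshift (n + n) i).
Definition var_u (i : 'I_n) : {mfps R[n + (n + n)]} :=
  mfps_X R (rshift n (lshift n i)).
Definition var_X (i : 'I_n) : {mfps R[n + (n + n)]} :=
  mfps_X R (rshift n (rshift n i)).

(* ubar X G(u) *)
Definition ubarXG (G : 'I_n -> {mfps R[n]}) : {mfps R[n + (n + n)]} :=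
  \sum_(i < n) var_ubar i * var_X i * mfps_comp (G i) var_u.

Lemma ubarXG0 G : ubarXG G 0%MM = 0.
Proof.
rewrite mfps_coef_sum big1 // => i _; rewrite -mulrA mfps_coefM big1 // => k.
move=> /eqP /esym/eqP; rewrite mnmD_eq0 => /andP[/eqP-> _].
by rewrite /= eq_sym mnm1_eq0 mul0r.
Qed.

Lemma var_u0 i : var_u i 0%MM = 0.
Proof. by rewrite /= eq_sym mnm1_eq0. Qed.

End Variables3.

Section Gauss.
Context (R : comNzRingType) (n : nat).
Implicit Types (b : 'X_{1..n}).

(* A map taking each value i exactly b i times (card_mnm_tau); [m2s b] is the
   sorted sequence of indices in which i occurs b i times. *)
Definition mnm_tau b (k : 'I_(mdeg b)) : 'I_n :=
  tnth (Tuple (introT eqP (size_m2s b))) k.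

Definition gauss_moment (b1 b2 : 'X_{1..n}) : R :=
  \sum_(s : {ffun 'I_(mdeg b1) -> 'I_(mdeg b2)} | `[< bijective s >])
    \prod_(k < mdeg b1) (@mnm_tau b2 (s k) == @mnm_tau b1 k)%:R.

Definition gauss_integrable (U : {mfps R[n + (n + n)]}) :=
  forall b3, finite_set [set b : 'X_{1..n} * 'X_{1..n} |
    U (mnm3 b.1 b.2 b3) * gauss_moment b.1 b.2 <> 0].

(* The coefficient of X^b3 is a sum over all (b1, b2); meaningful when U is
   integrable. *)
Definition gauss_int (U : {mfps R[n + (n + n)]}) : {mfps R[n]} :=
  MFps (fun b3 => \sum_(b \in [set: 'X_{1..n} * 'X_{1..n}])
    U (mnm3 b.1 b.2 b3) * gauss_moment b.1 b.2).

Lemma card_mnm_tau b i : #|[set k | @mnm_tau b k == i]%SET| = b i.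
Proof.
have Eb : b i = count_mem i (m2s b) by rewrite -[in LHS](s2mK b) mnmE.
have Em : m2s b = [seq @mnm_tau b k | k <- enum 'I_(mdeg b)].
  by rewrite [RHS](map_tnth_enum (Tuple (introT eqP (size_m2s b)))).
by rewrite Eb Em count_map cardsE cardE -size_filter enumT.
Qed.

End Gauss.

(* Main.v *)
(* Expanding exp(ubar X G(u)) and integrating ubar^b1 u^b2 to [b1 = b2] b1!,
   the coefficient of X^b in the Gaussian integral of Omega(u) e^(ubar X G(u))
   is the coefficient of u^b in Omega G^b.  For a series h(u) put
   Phi(h) = sum_b X^b [u^b] (h G^b).  Then Phi(u_i h) = X_i Phi(G_i h), and
   h |-> h(F) Phi(1) satisfies the same relation because F_i = X_i G_i(F); since
   such a linear map is determined by its value at 1, Phi(h) = h(F) Phi(1).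

   It remains to see that det(I - X dG(F)) Phi(1) = 1.  The coefficient of X^b
   is that of u^b in det(delta_ij A_i - (1/b_i) u_j d_j A_i) with A_i = G_i^b_i.
   Expanding each A_i into monomials u^(t_i) with t_1 + ... + t_n = b leaves the
   scalar matrices delta_ij - (t_i)_j / b_i, which are singular unless b = 0:
   weighting row i by b_i makes every column sum to b_j - sum_i (t_i)_j = 0. *)
Require Import Defs.
From HB Require Import structures.
From mathcomp Require Import all_boot all_order all_fingroup all_algebra.
From mathcomp Require Import boolp classical_sets cardinality fsbigop.
From mathcomp Require Import mpoly.

Set Implicit Arguments.
Unset Strict Implicit.
Unset Printing Implicit Defensive.

Import GRing.Theory.
Local Open Scope ring_scope.

(** * Coefficients and congruences of power series *)

Section PowerSeries.
Context (R : comNzRingType) (n : nat).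
Implicit Types (f g : {mfps R[n]}) (m k : 'X_{1..n}) (c : R).

Lemma mfps_coefD f g m : (f + g) m = f m + g m. Proof. by []. Qed.
Lemma mfps_coefN f m : (- f) m = - f m. Proof. by []. Qed.
Lemma mfps_coefZ c f m : (c *: f) m = c * f m. Proof. by []. Qed.
Lemma mfps_coef1 m : (1 : {mfps R[n]}) m = (m == 0%MM)%:R. Proof. by []. Qed.

Lemma mfps_coefMmono k f m :
  (mfps_mono R k * f) m = if (k <= m)%MM then f (m - k)%MM else 0.
Proof.
rewrite mfps_coefM; case: ifP => [le_km|/negbT nle_km]; last first.
  rewrite big1 // => -[k1 k2] /= /eqP Dm.
  have [k1E|] := eqVneq (k1 : 'X_{1..n}) k; last by rewrite mul0r.
  by have := lem_addr k1 k2; rewrite -Dm k1E (negPf nle_km).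
have lt_k : (mdeg k < (mdeg m).+1)%N.
  by rewrite ltnS -(submK le_km) mdegD leq_addl.
have lt_mk : (mdeg (m - k) < (mdeg m).+1)%N by rewrite ltnS mdegB.
rewrite (bigD1 (BMultinom lt_k, BMultinom lt_mk)) /=; last first.
  by rewrite addmC submK.
rewrite eqxx mul1r big1 ?addr0 // => -[k1 k2] /= /andP[/eqP Dm ne].
have [k1E|] := eqVneq (k1 : 'X_{1..n}) k; last by rewrite mul0r.
case/negP: ne; apply/eqP; congr (_, _); apply: val_inj => //=.
by have := addmK k k2; rewrite /= addmC -{1}k1E -Dm => <-.
Qed.

Lemma mfps_coefMX i f m :
  (mfps_X R i * f) m = if m i != 0%N then f (m - U_(i))%MM else 0.
Proof. by rewrite /mfps_X mfps_coefMmono lep1mP. Qed.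

Lemma mfps_coefMmonoD k f m : (mfps_mono R k * f) (k + m)%MM = f m.
Proof. by rewrite mfps_coefMmono lem_addr addmC addmK. Qed.

Lemma mfps_monoD m k : mfps_mono R (m + k)%MM = mfps_mono R m * mfps_mono R k.
Proof.
apply: mfpsP => j; rewrite mfps_coefMmono /=.
have [le_mj|nle] := boolP (m <= j)%MM.
  by rewrite -{1}(submK le_mj) (addmC m k) eqm_add2r.
by case: eqP nle => // ->; rewrite lem_addr.
Qed.

Lemma mfps_mono_sum I (r : seq I) (P : pred I) (F : I -> 'X_{1..n}) :
  mfps_mono R (\big[+%MM/0%MM]_(i <- r | P i) F i) =
  \prod_(i <- r | P i) mfps_mono R (F i).
Proof. exact: (big_morph (@mfps_mono R n) mfps_monoD). Qed.

Lemma mfps_monoMn m (k : nat) : mfps_mono R (m *+ k)%MM = mfps_mono R m ^+ k.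
Proof. by elim: k => // k IH; rewrite mulmS mfps_monoD IH exprS. Qed.

Lemma mfps_monoE m : mfps_mono R m = \prod_(i < n) mfps_X R i ^+ m i.
Proof.
rewrite {1}(multinomUE_id m) mfps_mono_sum.
by apply: eq_bigr => i _; rewrite mfps_monoMn.
Qed.

Lemma mfps_scaleAl c f g : c *: (f * g) = (c *: f) * g.
Proof.
apply: mfpsP => m; rewrite mfps_coefZ !mfps_coefM mulr_sumr.
by apply: eq_bigr => k _; rewrite mulrA.
Qed.

Lemma mfps_scaleAr c f g : c *: (f * g) = f * (c *: g).
Proof. by rewrite mulrC mfps_scaleAl mulrC. Qed.

Lemma mfps_prod_scale I (r : seq I) (P : pred I) (a : I -> R)
    (f : I -> {mfps R[n]}) :
  \prod_(i <- r | P i) (a i *: f i) =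
  (\prod_(i <- r | P i) a i) *: \prod_(i <- r | P i) f i.
Proof.
elim/big_rec3: _ => [|i x y z _ ->]; first by rewrite scale1r.
by rewrite -mfps_scaleAl -mfps_scaleAr scalerA.
Qed.

(** Constants as a ring morphism, the form in which [mmap] takes its action on coefficients. *)
Definition mfpsC c : {mfps R[n]} := c *: (1 : {mfps R[n]}).

Fact mfpsC_is_additive : additive mfpsC.
Proof. by move=> a b; rewrite /mfpsC scalerBl. Qed.
Fact mfpsC_is_multiplicative : multiplicative mfpsC.
Proof.
by split=> [a b|]; rewrite /mfpsC ?scale1r // -mfps_scaleAl mul1r scalerA.
Qed.
HB.instance Definition _ :=
  GRing.isAdditive.Build R {mfps R[n]} mfpsC mfpsC_is_additive.
HB.instance Definition _ :=
  GRing.isMultiplicative.Build R {mfps R[n]} mfpsC mfpsC_is_multiplicative.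

Lemma mul_mfpsC c f : mfpsC c * f = c *: f.
Proof. by rewrite /mfpsC -mfps_scaleAl mul1r. Qed.

Lemma mfps_eqmodP f g : (forall d, mfps_eqmod d f g) -> f = g.
Proof. by move=> fg; apply: mfpsP => m; apply: fg (ltnSn _). Qed.

Lemma mfps_eqmod_prod d I (r : seq I) (P : pred I) (f g : I -> {mfps R[n]}) :
    (forall i, P i -> mfps_eqmod d (f i) (g i)) ->
  mfps_eqmod d (\prod_(i <- r | P i) f i) (\prod_(i <- r | P i) g i).
Proof.
move=> fg; elim/big_rec2: _ => // i f' g' Pi IH.
by apply: mfps_eqmodM => //; apply: fg.
Qed.

Lemma mfps_eqmod_trunc d f :
  mfps_eqmod d f (\sum_(m : 'X_{1..n < d}) f m *: mfps_mono R m).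
Proof.
move=> m lt_md; rewrite mfps_coef_sum (bigD1 (BMultinom lt_md)) //=.
rewrite eqxx mulr1 big1 ?addr0 // => k; rewrite eqE /= eq_sym => /negPf ne.
by rewrite ne mulr0.
Qed.

(** Truncating each factor below degree [d] does not change the coefficient at [m], and the product
    then distributes over finite sums. *)
Lemma mfps_coef_prod (I : finType) (f : I -> {mfps R[n]}) d m :
    (mdeg m < d)%N ->
  (\prod_i f i) m =
    \sum_(t : {ffun I -> 'X_{1..n < d}} |
          m == \big[+%MM/0%MM]_i (t i : 'X_{1..n}))
      \prod_i f i (t i).
Proof.
move=> lt_md; transitivity
  ((\prod_i \sum_(k : 'X_{1..n < d}) f i k *: mfps_mono R k) m).
  by apply: mfps_eqmod_prod lt_md => i _; apply: mfps_eqmod_trunc.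
rewrite bigA_distr_bigA mfps_coef_sum [RHS]big_mkcond.
apply: eq_bigr => t _; rewrite mfps_prod_scale -mfps_mono_sum /=.
by case: eqP; rewrite ?mulr1 ?mulr0.
Qed.

End PowerSeries.

(** * Substitution *)

Section Composition.
Context (R : comNzRingType) (p n : nat) (F : 'I_p -> {mfps R[n]}).
Hypothesis F0 : forall i, F i 0%MM = 0.
Implicit Types (g h : {mfps R[p]}).

Lemma mfps_coef_prod_low (k : 'X_{1..p}) (m : 'X_{1..n}) :
  (mdeg m < mdeg k)%N -> (\prod_(i < p) F i ^+ k i) m = 0.
Proof.
rewrite (mdegE k); elim: (index_enum _) m => [|i r IH] m.
  by rewrite !big_nil.
by rewrite !big_cons; move: m; apply: mfps_prod_low IH; apply: mfps_exp_low.
Qed.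

(** As [F] has no constant term, the term of index [k] starts in degree [mdeg k] at the earliest. *)
Lemma mfps_comp_eqmod d g :
  mfps_eqmod d (mfps_comp g F)
    (\sum_(k : 'X_{1..p < d}) g k *: \prod_(i < p) F i ^+ k i).
Proof.
move=> m lt_md; rewrite mfps_coef_sum /=.
rewrite (fsbigE (map val (index_enum 'X_{1..p < d}))).
- rewrite big_map; apply: eq_bigl => k; exact: in_setT.
- by rewrite map_inj_uniq ?index_enum_uniq //; apply: val_inj.
- by [].
move=> k _ ks; rewrite /mfps_comp_term /= mfps_coef_prod_low ?mulr0 //.
apply: (leq_trans lt_md); rewrite leqNgt; apply: contra ks => lt_kd.
by apply/mapP; exists (BMultinom lt_kd); rewrite ?mem_index_enum.
Qed.

(** Modulo degree [d], substitution is evaluation of a polynomial; ring identities for [mfps_comp]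
    thus come from those for [mmap]. *)
Lemma mfps_comp_mmap d g (q : {mpoly R[p]}) :
    (forall k, (mdeg k < d)%N -> g k = q@_k) ->
  mfps_eqmod d (mfps_comp g F) (mmap (@mfpsC R n) F q).
Proof.
move=> gq m lt_md; pose e := maxn d (msize q).
rewrite (mmapE e) ?leq_maxr //.
rewrite (@mfps_comp_eqmod e) ?(leq_trans lt_md) ?leq_maxl //.
rewrite !mfps_coef_sum; apply: eq_bigr => k _; rewrite mul_mfpsC !mfps_coefZ.
have [lt_kd|le_dk] := ltnP (mdeg k) d; first by rewrite gq.
by rewrite (mfps_coef_prod_low (leq_trans lt_md le_dk)) !mulr0.
Qed.

Let trunc d g : {mpoly R[p]} := \sum_(k : 'X_{1..p < d}) g k *: 'X_[k].

Let truncE d g k : (mdeg k < d)%N -> g k = (trunc d g)@_k.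
Proof. by move=> lt_kd; rewrite mcoeff_mpoly. Qed.

Lemma mfps_compD g h : mfps_comp (g + h) F = mfps_comp g F + mfps_comp h F.
Proof.
apply: mfps_eqmodP => d m lt_md.
rewrite mfps_coefD !(mfps_comp_eqmod _ lt_md) !mfps_coef_sum -big_split.
by apply: eq_bigr => k _; rewrite /= mulrDl.
Qed.

Lemma mfps_comp1 : mfps_comp 1 F = 1.
Proof.
apply: mfps_eqmodP => d m lt_md.
rewrite (mfps_comp_mmap (d := d) (q := 1)) ?rmorph1 // => k _.
by rewrite mcoeff1.
Qed.

Lemma mfps_compM g h : mfps_comp (g * h) F = mfps_comp g F * mfps_comp h F.
Proof.
apply: mfps_eqmodP => d m lt_md.
rewrite (mfps_comp_mmap (d := d) (q := trunc d g * trunc d h)) //.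
  rewrite rmorphM; apply/esym; move: m lt_md.
  by apply: mfps_eqmodM; apply: mfps_comp_mmap => k; apply: truncE.
move=> k lt_kd; rewrite mfps_coefM mcoeffM; apply: eq_bigr => -[k1 k2] /= _.
by rewrite -!truncE // (leq_trans (bmdeg _)).
Qed.

Lemma mfps_compXn g k : mfps_comp (g ^+ k) F = mfps_comp g F ^+ k.
Proof.
by elim: k => [|k IH]; rewrite ?expr0 ?mfps_comp1 // !exprS mfps_compM IH.
Qed.

Lemma mfps_comp_prod I (r : seq I) (P : pred I) (g : I -> {mfps R[p]}) :
  mfps_comp (\prod_(i <- r | P i) g i) F =
  \prod_(i <- r | P i) mfps_comp (g i) F.
Proof.
exact: (big_morph (fun h => mfps_comp h F) mfps_compM mfps_comp1).
Qed.

Lemma mfps_compZ c g : mfps_comp (c *: g) F = c *: mfps_comp g F.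
Proof.
apply: mfps_eqmodP => d m lt_md; rewrite mfps_coefZ !(mfps_comp_eqmod _ lt_md).
rewrite !mfps_coef_sum mulr_sumr.
by apply: eq_bigr => k _; rewrite /= mulrA.
Qed.

Lemma mfps_compN g : mfps_comp (- g) F = - mfps_comp g F.
Proof. by rewrite -scaleN1r mfps_compZ scaleN1r. Qed.

Lemma mfps_comp0 : mfps_comp 0 F = 0.
Proof. by rewrite -(scale0r (0 : {mfps R[p]})) mfps_compZ scale0r. Qed.

Lemma mfps_comp_mono k :
  mfps_comp (mfps_mono R k) F = \prod_(i < p) F i ^+ k i.
Proof.
apply: mfps_eqmodP => d m lt_md.
rewrite (mfps_comp_mmap (d := d) (q := 'X_[k])) // => [|j _].
  by rewrite mmapX.
by rewrite mcoeffX /= eq_sym.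
Qed.

Lemma mfps_compX i : mfps_comp (mfps_X R i) F = F i.
Proof.
rewrite mfps_comp_mono (bigD1 i) //= big1 ?mulr1 => [|j /negPf ne].
  by rewrite mnm1E eqxx.
by rewrite mnm1E eq_sym ne.
Qed.

End Composition.

(** * Diagonal coefficients *)

Section Diagonal.
Context (R : comNzRingType) (n : nat).
Implicit Types (f g h : {mfps R[n]}) (G F : 'I_n -> {mfps R[n]}).

(** Each nonconstant monomial is divided by its variable of least index, so that exactly one summand
    accounts for it. *)
Lemma mfps_decomp f : exists q : 'I_n -> {mfps R[n]},
  f = mfpsC n (f 0%MM) + \sum_i mfps_X R i * q i.
Proof.
pose q (i : 'I_n) : {mfps R[n]} := MFps (fun m =>
  if [forall j : 'I_n, (j < i)%N ==> (m j == 0%N)]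
  then f (m + U_(i))%MM else 0).
exists q; apply: mfpsP => m.
rewrite mfps_coefD mfps_coefZ mfps_coef1 mfps_coef_sum.
have [->|m_neq0] := eqVneq m 0%MM.
  rewrite mulr1 big1 ?addr0 // => i _.
  by rewrite mfps_coefMX mnm0E eqxx.
have /existsP[i1 mi1] : [exists i, m i != 0%N].
  apply: contra_neqT m_neq0; rewrite negb_exists => /forallP m0.
  by apply/mnmP => i; rewrite mnm0E; apply/eqP; rewrite -[_ == _]negbK.
case: (@arg_minnP _ i1 (fun i => m i != 0%N) val mi1) => i mi i_min.
have qi : q i (m - U_(i))%MM = f m.
  rewrite /= submK ?lep1mP // ifT //.
  apply/forallP => j; apply/implyP => lt_ji; rewrite mnmBE mnm1E.
  have [-> //|/i_min] := eqVneq (m j) 0%N.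
  by rewrite /= leqNgt lt_ji.
rewrite mulr0 add0r (bigD1 i) // mfps_coefMX mi qi big1 => [|j].
  by rewrite /= addr0.
rewrite mfps_coefMX /= => ne_ji; case: ifP => // mj; rewrite ifF //.
apply/negbTE/forallPn; exists i.
rewrite negb_imply ltn_neqAle eq_sym ne_ji i_min //= mnmBE mnm1E.
by rewrite (negPf ne_ji) subn0.
Qed.

(** By induction on [d], [psi] vanishes modulo degree [d] on all series at once: after [mfps_decomp]
    the constant contributes nothing, and each [X_i] pulled out of [psi] gains one degree. *)
Lemma mfps_shift_unique G (psi : {mfps R[n]} -> {mfps R[n]}) :
    {morph psi : g h / g + h} -> scalable psi ->
    (forall i h, psi (mfps_X R i * h) = mfps_X R i * psi (G i * h)) ->
    psi 1 = 0 ->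
  forall h, psi h = 0.
Proof.
move=> psiD psiZ psiX psi1 h; apply: mfps_eqmodP => d; elim: d h => [//|d IH] h.
have psi0 : psi 0 = 0 by apply: (addIr (psi 0)); rewrite -psiD addr0 add0r.
have [q ->] := mfps_decomp h.
rewrite psiD psiZ psi1 scaler0 add0r (big_morph psi psiD psi0) => m lt_md.
rewrite mfps_coef_sum big1 // => i _.
by rewrite psiX (mfps_eqmod_X i (IH _) lt_md) mulr0.
Qed.

(* Phi(h) = sum_b X^b [u^b] (h G^b) *)
Definition mfps_diag G h : {mfps R[n]} :=
  MFps (fun b => (h * \prod_(i < n) G i ^+ b i) b).

Lemma mfps_coef_diag G h b :
  mfps_diag G h b = (h * \prod_(i < n) G i ^+ b i) b.
Proof. by []. Qed.

Lemma mfps_prodXD G (a b : 'X_{1..n}) : \prod_i G i ^+ (a + b)%MM i =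
  (\prod_i G i ^+ a i) * \prod_i G i ^+ b i.
Proof. by rewrite -big_split; apply: eq_bigr => i _; rewrite mnmDE exprD. Qed.

Lemma mfps_prodXU G i : \prod_(j < n) G j ^+ U_(i)%MM j = G i.
Proof.
rewrite (bigD1 i) //= big1 ?mulr1 => [|j /negPf ne].
  by rewrite mnm1E eqxx.
by rewrite mnm1E eq_sym ne.
Qed.

Lemma mfps_diagD G : {morph mfps_diag G : g h / g + h}.
Proof.
by move=> g h; apply: mfpsP => b; rewrite mfps_coefD !mfps_coef_diag mulrDl.
Qed.

Lemma mfps_diagZ G : scalable (mfps_diag G).
Proof.
move=> c h; apply: mfpsP => b.
by rewrite mfps_coefZ !mfps_coef_diag -mfps_scaleAl.
Qed.

(** Removing [X_i] lowers the exponent [b] to [b - U_(i)], and the factor [G i] thus split off [G^b]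
    joins [h]. *)
Lemma mfps_diagX G i h :
  mfps_diag G (mfps_X R i * h) = mfps_X R i * mfps_diag G (G i * h).
Proof.
apply: mfpsP => b; rewrite mfps_coef_diag -mulrA !mfps_coefMX.
case: ifP => // bi_neq0; rewrite mfps_coef_diag.
set b' := (b - U_(i))%MM; have -> : b = (U_(i) + b')%MM.
  by rewrite addmC submK ?lep1mP.
by rewrite mfps_prodXD mfps_prodXU mulrCA mulrA.
Qed.

Lemma mfps_diagE G F h :
    (forall i, F i 0%MM = 0) ->
    (forall i, F i = mfps_X R i * mfps_comp (G i) F) ->
  mfps_diag G h = mfps_comp h F * mfps_diag G 1.
Proof.
move=> F0 FE; apply/eqP; rewrite -subr_eq0; apply/eqP; move: h.
(* Uniqueness is applied to the difference of the two sides. *)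
apply: (@mfps_shift_unique G) => [g h|c h|i h|].
- by rewrite mfps_diagD mfps_compD // mulrDl opprD addrACA.
- by rewrite mfps_diagZ mfps_compZ // -mfps_scaleAl scalerBr.
- rewrite mfps_diagX !mfps_compM // mfps_compX // mulrBr {1}FE.
  by rewrite !mulrA.
by rewrite mfps_comp1 // mul1r subrr.
Qed.

End Diagonal.

(** * The determinant *)

Lemma mfps_coef_sign (R : comNzRingType) n (e : bool) (f : {mfps R[n]}) m :
  ((-1) ^+ e * f) m = (-1) ^+ e * f m.
Proof. by rewrite !mulr_sign; case: e. Qed.

Section Determinant.
Context (R : comNzRingType) (n : nat) (G F : 'I_n -> {mfps R[n]}).
Hypothesis F0 : forall i, F i 0%MM = 0.
Hypothesis FE : forall i, F i = mfps_X R i * mfps_comp (G i) F.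

(** The exponent [b i - 1] of [G i] accounts for the [X_i] in front. The value 0 at [b i = 0]
    reflects that a multiple of [X_i] has zero coefficient at an exponent free of [X_i]. *)
Definition mfps_Xpow (b : 'X_{1..n}) i : {mfps R[n]} :=
  if b i is k.+1 then mfps_X R i * G i ^+ k else 0.

(* On the diagonal, a factor [X_i] lowers the exponent of [G_i] by one; if that
   exponent is 0, both sides vanish. *)
Lemma mfps_coef_subset_diag (J : {set 'I_n}) (H K : 'I_n -> {mfps R[n]}) b :
  ((\prod_i if i \in J then mfps_X R i * mfps_comp (H i) F
            else mfps_comp (K i) F) * mfps_diag G 1) b =
  (\prod_i if i \in J then mfps_Xpow b i * H i else G i ^+ b i * K i) b.
Proof.
pose a : 'X_{1..n} := [multinom nat_of_bool (i \in J) | i < n].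
pose L i := if i \in J then H i else K i.
have -> : (\prod_i if i \in J then mfps_X R i * mfps_comp (H i) F
            else mfps_comp (K i) F) =
    mfps_mono R a * mfps_comp (\prod_i L i) F.
  rewrite mfps_comp_prod // mfps_monoE -big_split; apply: eq_bigr => i _ /=.
  by rewrite mnmE /L; case: ifP => _; rewrite ?mul1r.
(* [mfps_diagE] absorbs the factor [mfps_diag G 1], leaving [X^a] times Phi of the product of the
   [L i]. *)
rewrite -mulrA -(mfps_diagE _ F0 FE) mfps_coefMmono.
have [le_ab|/forallPn[i]] := boolP (a <= b)%MM; last first.
  rewrite -ltnNge mnmE; have [iJ|//] := boolP (i \in J).
  rewrite ltnS leqn0 => /eqP bi0.
  rewrite [X in _ = mfps_coef X b](_ : _ = 0) //.
  by rewrite (bigD1 i) //= iJ /mfps_Xpow bi0 !mul0r.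
rewrite mfps_coef_diag; transitivity
  ((mfps_mono R a *
    ((\prod_i L i) * \prod_i G i ^+ (b - a)%MM i)) (a + (b - a))%MM).
  by rewrite mfps_coefMmonoD.
rewrite addmC submK // mfps_monoE -!big_split; congr (mfps_coef _ b).
apply: eq_bigr => i _ /=; have /mnm_lepP/(_ i) := le_ab.
rewrite mnmBE mnmE /L; case: ifP => _; last by rewrite subn0 mul1r mulrC.
by rewrite /mfps_Xpow; case: (b i) => // k _; rewrite subn1 mulrA mulrAC.
Qed.

(** Both determinants are expanded by the Leibniz formula, and each product of binomials over the
    sets [J] of rows that contribute their first summand; terms then match one by one. *)
Lemma mfps_coef_det_diag (H K : 'I_n -> 'I_n -> {mfps R[n]}) b :
  (\det (\matrix_(i, j) (mfps_X R i * mfps_comp (H i j) F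
                         + mfps_comp (K i j) F)) * mfps_diag G 1) b =
  (\det (\matrix_(i, j) (mfps_Xpow b i * H i j + G i ^+ b i * K i j))) b.
Proof.
rewrite /determinant mulr_suml !mfps_coef_sum; apply: eq_bigr => s _.
under eq_bigr do rewrite mxE.
under [in RHS]eq_bigr do rewrite mxE.
rewrite !bigA_distr -mulrA mulr_suml.
rewrite !mfps_coef_sign; congr (_ * _); rewrite !mfps_coef_sum.
apply: eq_bigr => J _.
exact: mfps_coef_subset_diag.
Qed.

End Determinant.

(** * The Euler operators u_j d/du_j *)

Section Euler.
Context (R : comNzRingType) (n : nat).
Implicit Types (f g : {mfps R[n]}).

(** Unlike [mfps_deriv], this operator preserves monomials, so it acts on each coefficient by a
    scalar. *)
Definition mfps_euler (j : 'I_n) f : {mfps R[n]} := MFps (fun m => f m *+ m j).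

Lemma mfps_eulerE j f : mfps_X R j * mfps_deriv j f = mfps_euler j f.
Proof.
apply: mfpsP => m; rewrite mfps_coefMX /=; case: eqP => [->|/eqP mj] //=.
by rewrite submK ?lep1mP // mnmBE mnm1E eqxx subn1 prednK ?lt0n.
Qed.

Lemma mfps_eulerM j f g :
  mfps_euler j (f * g) = mfps_euler j f * g + f * mfps_euler j g.
Proof.
apply: mfpsP => m; rewrite mfps_coefD !mfps_coefM -big_split /= -sumrMnl.
apply: eq_bigr => -[k1 k2] /= /eqP/(congr1 (fun k : 'X_{1..n} => k j)).
by rewrite mnmDE => ->; rewrite mulrnAl mulrnAr mulrnDr.
Qed.

Lemma mfps_eulerX j f k :
  mfps_euler j (f ^+ k) = (f ^+ k.-1 * mfps_euler j f) *+ k.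
Proof.
elim: k => [|[|k] IH].
- apply: mfpsP => m; rewrite expr0 mulr0n [LHS]/=.
  by case: eqP => [->|]; rewrite ?mnm0E ?mul0rn.
- by rewrite expr1 expr0 mul1r.
by rewrite exprS mfps_eulerM IH mulrnAr mulrA -exprS [RHS]mulrS mulrC.
Qed.

End Euler.

(** The adjugate replaces division, as [R] may have zero divisors; [\det M] itself vanishes as soon
    as [v 0 i] is invertible. *)
Lemma det_eq0_left_ker (R : comNzRingType) n (M : 'M[R]_n) (v : 'rV[R]_n) i :
  v *m M = 0 -> v 0 i * \det M = 0.
Proof.
move=> vM0; have : v *m (M *m \adj M) = 0 by rewrite mulmxA vM0 mul0mx.
rewrite mul_mx_adj mul_mx_scalar => /matrixP/(_ 0 i).
by rewrite !mxE mulrC.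
Qed.

(** * The identity det(I - X dG(F)) Phi(1) = 1 *)

Section LagrangeGood.
Context (R : comAlgType rat) (n : nat).

(* [natV 0 = 0] *)
Definition natV (k : nat) : R := (k%:R^-1 : rat)%:A.

Lemma natVK k : k != 0%N -> natV k * k%:R = 1.
Proof.
move=> k_neq0; rewrite /natV -scalerAl mul1r.
have -> : k%:R = k%:R *: 1 :> R by rewrite scaler_nat.
by rewrite scalerA mulVf ?scale1r // Num.Theory.pnatr_eq0.
Qed.

Section Euler.
Variables (A : 'I_n -> {mfps R[n]}) (b : 'X_{1..n}).
Hypothesis A1 : forall i, b i = 0%N -> A i = 1.

Let N : 'M[{mfps R[n]}]_n :=
  \matrix_(i, j) ((i == j)%:R * A i - natV (b i) *: mfps_euler j (A i)).

(* The coefficient of a product of monomials [u^(t i)], [i < n], of total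
   exponent [b] is the determinant of a matrix whose rows, weighted by the
   entries of [b], add up to 0. *)
Lemma mfps_coef_det_euler : b != 0%MM -> (\det N) b = 0.
Proof.
move=> b_neq0; pose d := (mdeg b).+1.
(* The Euler operator scales the coefficient of [u^(t i)] by [t i j], so [A i (t i)] factors out of
   row [i] and leaves the scalar matrix [M t]. *)
pose M (t : {ffun 'I_n -> 'X_{1..n < d}}) : 'M[R]_n :=
  \matrix_(i, j) ((i == j)%:R - natV (b i) * (t i j)%:R).
transitivity (\sum_(t : {ffun 'I_n -> 'X_{1..n < d}} |
      b == \big[+%MM/0%MM]_i (t i : 'X_{1..n}))
    (\prod_i A i (t i)) * \det (M t)).
  rewrite /determinant mfps_coef_sum.
  under [RHS]eq_bigr do rewrite mulr_sumr.
  rewrite [RHS]exchange_big; apply: eq_bigr => s _.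
  rewrite mfps_coef_sign (mfps_coef_prod _ (ltnSn _)) mulr_sumr.
  apply: eq_bigr => t _; rewrite mulrCA -big_split; congr (_ * _).
  apply: eq_bigr => i _; rewrite !mxE mfps_coefD mfps_coefN mfps_coefZ.
  rewrite -[RHS]/(A i (t i) * (_ - _)) mulrBr; congr (_ - _).
    by case: (i == _); rewrite ?mul1r ?mulr1 ?mul0r ?mulr0.
  by rewrite mulrCA mulr_natr.
apply: big1 => t /eqP bE.
(* Where [b i = 0], [natV (b i)] is 0 and not an inverse. There [A i = 1], so only terms with
   [t i = 0] survive, which the column sums require. *)
have [/existsP[i /andP[/eqP bi0 ti]]|/existsPn tP] :=
    boolP [exists i, (b i == 0%N) && (t i != 0%MM :> 'X_{1..n})].
  by rewrite (bigD1 i) //= (A1 bi0) mfps_coef1 (negPf ti) !mul0r.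
have t0 i : b i = 0%N -> t i = 0%MM :> 'X_{1..n}.
  by move=> bi0; have := tP i; rewrite bi0 eqxx => /negPn/eqP.
(* A nonzero entry of [b] is invertible in the rational algebra [R], so a left kernel vector with
   this entry kills the determinant. *)
have /existsP[i0 bi0] : [exists i, b i != 0%N].
  apply: contra_neqT b_neq0 => /existsPn b0.
  by apply/mnmP => i; rewrite mnm0E; apply/eqP/negPn.
pose v : 'rV[R]_n := \row_i (b i)%:R.
suff vM : v *m M t = 0.
  have := det_eq0_left_ker i0 vM; rewrite mxE => detM.
  by rewrite -[\det _]mul1r -(natVK bi0) -mulrA detM !mulr0.
apply/rowP => j; rewrite !mxE.
under eq_bigr => i _ do rewrite !mxE mulrBr.
rewrite sumrB (bigD1 j) //= eqxx mulr1 big1 => [|i /negPf->]; last first.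
  by rewrite mulr0.
rewrite addr0 [in X in X - _]bE mnm_sumE natr_sum; apply/eqP; rewrite subr_eq0.
apply/eqP; apply: eq_bigr => i _.
have [bi|bi] := eqVneq (b i) 0%N; first by rewrite (t0 _ bi) mnm0E bi !mul0r.
by rewrite mulrA [_ * natV _]mulrC natVK // mul1r.
Qed.

Lemma mfps_coef_det_euler0 : b = 0%MM -> (\det N) b = 1.
Proof.
move=> b0; rewrite (_ : N = 1%:M) ?det1 ?b0 ?mfps_coef1 ?eqxx //.
apply/matrixP => i j; rewrite !mxE A1 ?b0 ?mnm0E // mulr1.
rewrite [natV _](_ : _ = 0) ?scale0r ?subr0 //.
by rewrite /natV invr0 scale0r.
Qed.

End Euler.

Variables (G F : 'I_n -> {mfps R[n]}).
Hypothesis F0 : forall i, F i 0%MM = 0.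
Hypothesis FE : forall i, F i = mfps_X R i * mfps_comp (G i) F.

Lemma det_XdG_diag : \det (1%:M - XdG G F) * mfps_diag G 1 = 1.
Proof.
apply: mfpsP => b; rewrite mfps_coef1.
pose A i := G i ^+ b i.
pose N : 'M[{mfps R[n]}]_n :=
  \matrix_(i, j) ((i == j)%:R * A i - natV (b i) *: mfps_euler j (A i)).
have A1 i : b i = 0%N -> A i = 1 by rewrite /A => ->.
suff -> : (\det (1%:M - XdG G F) * mfps_diag G 1) b = (\det N) b.
  have [b0|b0] := eqVneq b 0%MM.
    exact: mfps_coef_det_euler0.
  exact: mfps_coef_det_euler.
pose N' : 'M[{mfps R[n]}]_n := \matrix_(i, j)
  (mfps_Xpow G b i * (- mfps_deriv j (G i)) + A i * (i == j)%:R).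
have -> : 1%:M - XdG G F = \matrix_(i, j)
    (mfps_X R i * mfps_comp (- mfps_deriv j (G i)) F
     + mfps_comp (i == j)%:R F).
  apply/matrixP => i j; rewrite !mxE addrC mfps_compN // mulrN.
  congr (_ + _); case: (i == j); rewrite ?mfps_comp1 //.
  by rewrite mfps_comp0.
rewrite mfps_coef_det_diag // -/N'; congr (mfps_coef _ b).
pose x : 'rV[{mfps R[n]}]_n := \row_i mfps_X R i.
(* Conjugating by diag(X) trades the factor [X_i] of row i for the factor [X_j]
   of column j, which turns [d_j] into the Euler operator. *)
have xN : N' *m diag_mx x = diag_mx x *m N.
  apply/matrixP => i j; rewrite mul_mx_diag mul_diag_mx !mxE.
  rewrite mulrDl mulrBr addrC; congr (_ + _).
    have [->|_] := eqVneq i j; last by rewrite mulr0 !mul0r mulr0.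
    by rewrite mulr1 mul1r mulrC.
  (* For [b i = k.+1] this is the power rule divided by [b i]; for [b i = 0] both sides vanish by
     the conventions of [mfps_Xpow] and [natV]. *)
  rewrite /mfps_Xpow /A; case: (b i) => [|k].
    by rewrite /natV invr0 scale0r scale0r !mul0r mulr0 oppr0.
  rewrite mfps_eulerX -scaler_nat scalerA natVK // scale1r -mfps_eulerE.
  by rewrite !mulrN mulNr -!mulrA [mfps_deriv _ _ * _]mulrC.
have := congr1 determinant xN; rewrite !det_mulmx det_diag.
pose k : 'X_{1..n} := [multinom 1%N | i < n].
have -> : \prod_i x 0 i = mfps_mono R k.
  by rewrite mfps_monoE; apply: eq_bigr => i _; rewrite mxE mnmE.
(* The monomial [X^k] is cancelled, without inverting it, by comparing coefficients at exponents
   shifted by [k]. *)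
rewrite mulrC => NE; apply: mfpsP => m.
by rewrite -(mfps_coefMmonoD k) NE mfps_coefMmonoD.
Qed.

Lemma unit_det_XdG : \det (1%:M - XdG G F) \is a GRing.unit.
Proof.
by apply/unitrPr; exists (mfps_diag G 1); apply: det_XdG_diag.
Qed.

Lemma mfps_diag_det h :
  mfps_comp h F * (\det (1%:M - XdG G F))^-1 = mfps_diag G h.
Proof.
apply: (mulIr unit_det_XdG); rewrite divrK ?unit_det_XdG //.
by rewrite (mfps_diagE h F0 FE) -mulrA [_ * \det _]mulrC det_XdG_diag mulr1.
Qed.

End LagrangeGood.

(** * Gaussian moments *)

Section FiberPerms.
Context (T I : finType) (f : T -> I).

Let fiber i := [set x | f x == i].
(** Confining the moved points to the fibers over [r] permits an induction that adds one fiber at a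
    time. *)
Let Aut (r : seq I) := [set s : {perm T} |
  perm_on [set x | f x \in r] s && [forall x, f (s x) == f x]].

(** Such a permutation factors uniquely into a permutation of the fiber over [c] and an element of
    [Aut r], which fixes that fiber pointwise. *)
Let Aut_cons c r : c \notin r ->
  #|Aut (c :: r)| = ((#|fiber c|)`! * #|Aut r|)%N.
Proof.
move=> c_r; pose mu (p : {perm T} * {perm T}) := (p.1 * p.2)%g.
have cE x : (x \in fiber c) = (f x == c) by rewrite inE.
rewrite -card_perm -[X in (X * _)%N]cardsE -cardsX -(@card_in_imset _ _ mu).
  apply: eq_card => h; apply/idP/imsetP => [|[[u v]]]; last first.
    rewrite !inE /= => /andP[u_c /andP[v_r /forallP fv] ->].
    have fu x : f (u x) = f x.
      have [xc|xc] := boolP (x \in fiber c); last by rewrite (out_perm u_c).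
      by move: xc (xc); rewrite -{1}(perm_closed x u_c) !cE => /eqP-> /eqP.
    apply/andP; split; last first.
      by apply/forallP => x; rewrite permM (eqP (fv _)) fu.
    apply: perm_onM; apply/fintype.subsetP => x.
      by move=> /(fintype.subsetP u_c); rewrite !inE => ->.
    by move=> /(fintype.subsetP v_r); rewrite !inE => ->; rewrite orbT.
  rewrite inE => /andP[h_r /forallP fh].
  have fhE x : f (h x) = f x by apply/eqP.
  (* The first factor agrees with [h] on the fiber over [c] and fixes every other point. *)
  have u_inj : injective (fun x => if f x == c then h x else x).
    move=> x y; case: eqP => [fx|fx]; case: eqP => [fy|fy] //.
    - exact: perm_inj.
    - by move=> hx; case: fy; rewrite -hx fhE.
    - by move=> hy; case: fx; rewrite hy fhE.
  pose u := perm u_inj.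
  have u_c : perm_on (fiber c) u.
    apply/fintype.subsetP => x; rewrite !inE permE.
    by case: ifP => //; rewrite eqxx.
  have uVc := perm_onV u_c.
  exists (u, u^-1 * h)%g; last by rewrite /mu /= mulKVg.
  have u_in : u \in perm_on (fiber c) by [].
  rewrite !inE /= u_in /=; apply/andP; split.
    apply/fintype.subsetP => x; rewrite !inE permM; apply: contra_neqT => x_r.
    have [xc|xc] := boolP (x \in fiber c).
      have : (u^-1)%g x \in fiber c by rewrite perm_closed.
      rewrite cE => uxc; have := permKV u x; rewrite {1}/u permE.
      by rewrite uxc.
    rewrite (out_perm uVc) // (out_perm h_r) // !inE negb_or x_r andbT.
    by rewrite -cE.
  apply/forallP => x; rewrite permM fhE.
  have [xc|xc] := boolP (x \in fiber c); last by rewrite (out_perm uVc).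
  by move: xc (xc); rewrite -{1}(perm_closed x uVc) !cE => /eqP-> /eqP->.
(* Injectivity: [v] and [v'] fix the fiber over [c], so [u] and [u'] agree on it, and both are the
   identity elsewhere. *)
move=> [u v] [u' v']; rewrite !inE /= => /andP[u_c /andP[v_r _]].
move=> /andP[u'_c /andP[v'_r _]] E.
have vc (w : {perm T}) x : perm_on [set x | f x \in r] w -> x \in fiber c ->
    w x = x.
  by move=> w_r; rewrite cE => /eqP xc; rewrite (out_perm w_r) // inE xc.
suff uu' : u = u' by move: E; rewrite /mu /= uu' => /mulgI->.
apply/permP => x; have [xc|xc] := boolP (x \in fiber c); last first.
  by rewrite (out_perm u_c) // (out_perm u'_c).
have /permP/(_ x) := E; rewrite !permM /=.
by rewrite (vc v) ?(vc v') // perm_closed.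
Qed.

Lemma card_fiber_perm :
  #|[set s : {perm T} | [forall x, f (s x) == f x]]| =
  (\prod_i (#|[set x | f x == i]|)`!)%N.
Proof.
have AutE r : uniq r -> #|Aut r| = (\prod_(i <- r) (#|fiber i|)`!)%N.
  elim: r => [_|c r IH /= /andP[c_r /IH{}IH]]; last first.
    by rewrite Aut_cons // IH big_cons.
  rewrite big_nil; apply/eqP/cards1P; exists 1%g.
  apply/setP => s; rewrite !inE; apply/andP/eqP => [[s0 _]|->].
    by apply/permP => x; rewrite perm1 (out_perm s0) // inE.
  by rewrite perm_on1; split=> //; apply/forallP => x; rewrite perm1.
rewrite -AutE ?index_enum_uniq //; apply: eq_card => s; rewrite !inE.
case: [forall x, _]; rewrite ?andbF // andbT; apply/esym/fintype.subsetP => x _.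
by rewrite inE mem_index_enum.
Qed.

End FiberPerms.

Section Moment.
Context (R : comNzRingType) (n : nat).
Implicit Types (b : 'X_{1..n}).

(** A nonzero summand yields a bijection that matches the fibers of the two maps [mnm_tau], whose
    sizes are the exponents. *)
Lemma gauss_moment_neq b1 b2 : b1 != b2 -> gauss_moment R b1 b2 = 0.
Proof.
move=> ne_b; apply: big1 => s /asboolP s_bij; apply/eqP.
apply: contraNT ne_b => nz; apply/eqP/mnmP => i.
rewrite -card_mnm_tau -(card_mnm_tau b2) -(on_card_preimset (f := s)).
  apply: eq_card => k; rewrite !inE; congr (_ == _).
  apply/esym/eqP; apply: contraNT nz => ne.
  by rewrite (bigD1 k) //= (negPf ne) mul0r.
exact: onW_bij.
Qed.

(** A bijection contributes 1 if it preserves the fibers of [mnm_tau] and 0 otherwise;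
    [card_fiber_perm] counts the former. *)
Lemma gauss_moment_eq b :
  gauss_moment R b b = (\prod_(i < n) (b i)`!)%:R.
Proof.
have valE (s : {perm 'I_(mdeg b)}) : fun_of_fin (val s) = s := pvalE s.
under eq_bigr => i _ do rewrite -card_mnm_tau.
rewrite -card_fiber_perm -sum1_card natr_sum /gauss_moment.
(* Bijective functions are reindexed by permutations; the identity only serves as the default of
   [insubd] on functions that are not injective. *)
rewrite (reindex_onto (fun s : {perm 'I_(mdeg b)} => val s)
  (insubd (1%g : {perm 'I_(mdeg b)}))) => [|s /asboolP s_bij]; last first.
  by rewrite insubdK //; apply/injectiveP/bij_inj.
under eq_bigl => s.
  rewrite valKd eqxx andbT (_ : `[< _ >] = true); first over.
  apply/asboolP; rewrite valE.
  by apply: (@Bijective _ _ s s^-1%g); [apply: permK|apply: permKV].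
rewrite [RHS]big_mkcond; apply: eq_bigr => s _; rewrite inE.
case: ifPn => [/forallP fs|/forallPn[x /negPf sx]].
  by rewrite big1 // => k _; rewrite valE fs.
by rewrite (bigD1 x) //= valE sx mul0r.
Qed.

End Moment.

(** * The exponential of a sum *)

Section Exponential.
Context (R : comAlgType rat).

(** Multinomial formula with denominators cleared. Peeling off one factor [X_i] uses
    [m! = m_i (m - U_(i))!], and the weights [m_i] add up to [mdeg m]. *)
Lemma mfps_coef_sumX_exp n k (m : 'X_{1..n}) :
  ((\sum_i mfps_X R i) ^+ k) m * (\prod_i (m i)`!)%:R =
  if mdeg m == k then k`!%:R else 0.
Proof.
elim: k m => [|k IH] m.
  rewrite expr0 mfps_coef1 mdeg_eq0; case: eqP => [->|_]; last by rewrite mul0r.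
  by rewrite big1 ?mulr1 // => i _; rewrite mnm0E.
rewrite exprS [_ * _ ^+ k]mulr_suml mfps_coef_sum mulr_suml.
transitivity (\sum_i (m i)%:R * (if mdeg m == k.+1 then k`!%:R else 0) : R).
  apply: eq_bigr => i _; rewrite mfps_coefMX.
  have [->|mi] := eqVneq (m i) 0%N; first by rewrite !mul0r.
  have le_m : (U_(i) <= m)%MM by rewrite lep1mP.
  have -> : (mdeg m == k.+1) = (mdeg (m - U_(i)) == k).
    by rewrite -{1}(submK le_m) mdegD mdeg1 addn1 eqSS.
  rewrite -IH mulrCA -natrM; congr (_ * _%:R).
  rewrite (bigD1 i) //= [in RHS](bigD1 i) //= mulnA mnmBE mnm1E eqxx subn1.
  rewrite -{1}(prednK (n := m i)) ?lt0n // factS prednK ?lt0n //.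
  congr (_ * _)%N.
  by apply: eq_bigr => j /negPf ne; rewrite mnmBE mnm1E eq_sym ne subn0.
rewrite -mulr_suml -natr_sum -mdegE; case: eqP => [->|_]; last by rewrite mulr0.
by rewrite -natrM -factS.
Qed.

Lemma mfps_exp_eqmod n d (f : {mfps R[n]}) : f 0%MM = 0 ->
  mfps_eqmod d (mfps_exp f) (\sum_(k < d) mfps_exp_term f k).
Proof.
move=> f0 m lt_md; rewrite mfps_coef_sum /=.
rewrite (fsbigE (index_iota 0 d)) ?iota_uniq // => [|k _].
  by rewrite big_mkord; apply: eq_bigl => k; exact: in_setT.
rewrite mem_index_iota /= -leqNgt => le_dk.
by rewrite /mfps_exp_term /= mfps_exp_low ?mulr0 // (leq_trans lt_md).
Qed.

(* exp(X_1 + ... + X_n) *)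
Definition mfps_expX n : {mfps R[n]} :=
  MFps (fun m => natV R (\prod_i (m i)`!)).

Lemma mfps_expX_eqmod n d :
  mfps_eqmod d (\sum_(k < d) mfps_exp_term (\sum_i mfps_X R i) k)
    (mfps_expX n).
Proof.
move=> m lt_md; rewrite mfps_coef_sum [RHS]/=.
have nz : (\prod_i (m i)`! != 0)%N.
  by rewrite -lt0n prodn_gt0 // => i; apply: fact_gt0.
have SE k : mfps_exp_term (\sum_(i < n) mfps_X R i) k m =
    if mdeg m == k then natV R (\prod_i (m i)`!)%N else 0.
  rewrite -[LHS]/(natV R k`! * ((\sum_i mfps_X R i) ^+ k) m).
  have := congr1 ( *%R^~ (natV R (\prod_i (m i)`!)%N)) (mfps_coef_sumX_exp k m).
  rewrite /= -mulrA [_%:R * natV _ _]mulrC natVK // mulr1 => ->.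
  case: eqP => _; last by rewrite mul0r mulr0.
  by rewrite mulrA natVK ?mul1r // -lt0n fact_gt0.
rewrite (eq_bigr _ (fun (k : 'I_d) _ => SE k)).
rewrite (bigD1 (Ordinal lt_md)) //= eqxx [X in _ + X]big1 ?addr0 // => k ne.
by case: eqP => // mk; case/eqP: ne; apply: val_inj.
Qed.

(** Grouping by monomials in [y], not by powers of the sum, makes the exponent of each [y i]
    visible. The identity is the one for independent variables with [y] substituted. *)
Lemma mfps_exp_sum p n (y : 'I_p -> {mfps R[n]}) :
    (forall i, y i 0%MM = 0) ->
  mfps_exp (\sum_i y i) = mfps_comp (mfps_expX p) y.
Proof.
move=> y0; apply: mfps_eqmodP => d m lt_md.
have yE : \sum_i y i = mfps_comp (\sum_i mfps_X R i) y.
  rewrite (big_morph (fun g => mfps_comp g y) (mfps_compD y0) (mfps_comp0 y0)).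
  by apply: eq_bigr => i _; rewrite mfps_compX.
rewrite (mfps_exp_eqmod _ lt_md); last first.
  by rewrite mfps_coef_sum big1.
have -> : \sum_(k < d) mfps_exp_term (\sum_i y i) k =
    mfps_comp (\sum_(k < d) mfps_exp_term (\sum_i mfps_X R i) k) y.
  rewrite (big_morph (fun g => mfps_comp g y) (mfps_compD y0) (mfps_comp0 y0)).
  by apply: eq_bigr => k _; rewrite mfps_compZ // mfps_compXn // -yE.
rewrite !(mfps_comp_eqmod y0 _ lt_md) !mfps_coef_sum; apply: eq_bigr => k _.
by rewrite !mfps_coefZ (mfps_expX_eqmod (bmdeg k)).
Qed.

End Exponential.

(** * The Gaussian integral *)

Section Gaussian.
Context (R : comAlgType rat) (n : nat).
Implicit Types (b : 'X_{1..n}).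

Lemma mnm3E b1 b2 b3 :
  (forall i, mnm3 b1 b2 b3 (lshift (n + n) i) = b1 i) *
  (forall i, mnm3 b1 b2 b3 (rshift n (lshift n i)) = b2 i) *
  (forall i, mnm3 b1 b2 b3 (rshift n (rshift n i)) = b3 i).
Proof.
by split; [split|] => i;
  rewrite /fun_of_multinom /= ?tnth_lshift ?tnth_rshift ?tnth_lshift
    ?tnth_rshift.
Qed.

Lemma mfps_mono_mnm3 b1 b2 b3 : mfps_mono R (mnm3 b1 b2 b3) =
  (\prod_i var_ubar R i ^+ b1 i) * (\prod_i var_u R i ^+ b2 i)
  * (\prod_i var_X R i ^+ b3 i).
Proof.
rewrite mfps_monoE !big_split_ord /= mulrA.
by congr (_ * _ * _); apply: eq_bigr => i _; rewrite mnm3E.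
Qed.

Lemma mdeg_mnm3 b1 b2 b3 :
  mdeg (mnm3 b1 b2 b3) = (mdeg b1 + mdeg b2 + mdeg b3)%N.
Proof.
rewrite !mdegE !big_split_ord /= addnA.
by congr (_ + _ + _)%N; apply: eq_bigr => i _; rewrite mnm3E.
Qed.

Lemma mnm3_inj b1 b2 b3 c1 c2 c3 :
  mnm3 b1 b2 b3 = mnm3 c1 c2 c3 -> [/\ b1 = c1, b2 = c2 & b3 = c3].
Proof.
move=> /mnmP E; split; apply/mnmP => i.
- by have := E (lshift _ i); rewrite !mnm3E.
- by have := E (rshift _ (lshift _ i)); rewrite !mnm3E.
by have := E (rshift _ (rshift _ i)); rewrite !mnm3E.
Qed.

Lemma mnm3_ext (m m' : 'X_{1..n + (n + n)}) :
    (forall i, m (lshift (n + n) i) = m' (lshift (n + n) i)) ->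
    (forall i, m (rshift n (lshift n i)) = m' (rshift n (lshift n i))) ->
    (forall i, m (rshift n (rshift n i)) = m' (rshift n (rshift n i))) ->
  m = m'.
Proof.
move=> E1 E2 E3; apply/mnmP => i; rewrite -(splitK i).
case: (fintype.split i) => //= j; rewrite -(splitK j).
by case: (fintype.split j).
Qed.

Lemma mnm3_surj (m : 'X_{1..n + (n + n)}) :
  exists b1 b2 b3, m = mnm3 b1 b2 b3.
Proof.
exists [multinom m (lshift (n + n) i) | i < n].
exists [multinom m (rshift n (lshift n i)) | i < n].
exists [multinom m (rshift n (rshift n i)) | i < n].
by apply: mnm3_ext => i; rewrite mnm3E mnmE.
Qed.

Lemma mnm3_shift k b1 b2 b3 : (mnm3 k 0 k + mnm3 b1 b2 b3 =
  mnm3 (k + b1) b2 (k + b3))%MM.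
Proof.
by apply: mnm3_ext => i; rewrite mnmDE !mnm3E ?mnm0E ?mnmDE.
Qed.

Lemma prodX0 (S : comNzRingType) (f : 'I_n -> S) :
  \prod_i f i ^+ (0%MM : 'X_{1..n}) i = 1.
Proof. by apply: big1 => i _; rewrite mnm0E. Qed.

Lemma mfps_coef_comp_u (h : {mfps R[n]}) b1 b2 b3 :
  mfps_comp h (@var_u R n) (mnm3 b1 b2 b3) =
  if (b1 == 0%MM) && (b3 == 0%MM) then h b2 else 0.
Proof.
rewrite (mfps_comp_eqmod (@var_u0 R n) _ (ltnSn _)) mfps_coef_sum.
set d := (mdeg _).+1.
have lt_b2 : (mdeg b2 < d)%N.
  by rewrite ltnS mdeg_mnm3 -addnA addnCA leq_addr.
have uE (k : 'X_{1..n}) :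
    \prod_i var_u R i ^+ k i = mfps_mono R (mnm3 0%MM k 0%MM).
  by rewrite mfps_mono_mnm3 !prodX0 mul1r mulr1.
under eq_bigr => k _ do rewrite uE mfps_coefZ /=.
rewrite (bigD1 (BMultinom lt_b2)) //= [X in _ + X]big1 ?addr0 => [|k ne].
  case: ifP => [/andP[/eqP-> /eqP->]|nz]; first by rewrite eqxx mulr1.
  case: eqP => [/mnm3_inj[b10 _ b30]|_]; last by rewrite mulr0.
  by rewrite b10 b30 !eqxx in nz.
case: eqP => [/mnm3_inj[_ b2k _]|_]; last by rewrite mulr0.
by case/eqP: ne; apply: val_inj; rewrite /= b2k.
Qed.

(** With [y_i = ubar_i X_i G_i(u)], the term of index [k] of the exponential carries exactly
    [ubar^k X^k], all else being a series in [u]; this forces [k = b1 = b3]. *)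
Lemma mfps_coef_gauss_integrand (G : 'I_n -> {mfps R[n]})
    (a : 'X_{1..n}) b1 b2 b3 :
  ((\prod_i var_u R i ^+ a i) * mfps_exp (ubarXG G)) (mnm3 b1 b2 b3) =
  if b1 == b3 then
    natV R (\prod_i (b1 i)`!) * (mfps_mono R a * \prod_i G i ^+ b3 i) b2
  else 0.
Proof.
pose y i := var_ubar R i * var_X R i * mfps_comp (G i) (@var_u R n).
have y0 i : y i 0%MM = 0.
  rewrite /y -mulrA mfps_coefMX.
  by rewrite mnm0E.
rewrite /ubarXG -/y (mfps_exp_sum y0).
have lt_m := ltnSn (mdeg (mnm3 b1 b2 b3)); set d := (mdeg _).+1 in lt_m.
rewrite (mfps_eqmodM (fun _ _ => erefl)
  (mfps_comp_eqmod y0 (mfps_expX R n)) lt_m).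
rewrite mulr_sumr mfps_coef_sum.
have termE (k : 'X_{1..n}) :
    ((\prod_i var_u R i ^+ a i) * (mfps_expX R n k *: \prod_i y i ^+ k i))
       (mnm3 b1 b2 b3) =
    if (k == b1) && (k == b3) then
      natV R (\prod_i (k i)`!) * (mfps_mono R a * \prod_i G i ^+ k i) b2
    else 0.
  rewrite -mfps_scaleAr mfps_coefZ.
  have -> : \prod_i y i ^+ k i = mfps_mono R (mnm3 k 0%MM k)
      * mfps_comp (\prod_i G i ^+ k i) (@var_u R n).
    rewrite mfps_mono_mnm3 prodX0 mulr1.
    rewrite (mfps_comp_prod (@var_u0 R n)) -!big_split.
    apply: eq_bigr => i _ /=.
    by rewrite mfps_compXn ?exprMn //; apply: var_u0.
  rewrite -(mfps_comp_mono (@var_u0 R n)) mulrCA -mfps_compM; last first.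
    exact: var_u0.
  rewrite [in LHS]mfps_coefMmono.
  have [le_k|nle_k] := boolP (mnm3 k 0 k <= mnm3 b1 b2 b3)%MM; last first.
    rewrite mulr0; case: ifP => // /andP[/eqP kb1 /eqP kb3].
    case/negP: nle_k; rewrite -kb1 -kb3 -{3 4}(addm0 k) -mnm3_shift.
    exact: lem_addr.
  set b := (_ - _)%MM.
  have bE : (mnm3 k 0 k + b = mnm3 b1 b2 b3)%MM by rewrite addmC submK.
  have [c1 [c2 [c3 bc]]] := mnm3_surj b.
  have [<- <- <-] : [/\ (k + c1 = b1)%MM, c2 = b2 & (k + c3 = b3)%MM].
    by apply: mnm3_inj; rewrite -mnm3_shift -bc.
  have eqk c : (k == (k + c)%MM) = (c == 0%MM).
    by rewrite -{1}(addm0 k) eqm_add2l eq_sym.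
  rewrite bc mfps_coef_comp_u !eqk.
  by case: ifP => _; rewrite ?mulr0.
rewrite (eq_bigr _ (fun (k : 'X_{1..n < d}) _ => termE k)).
case: eqP => [<-|ne]; last first.
  by apply: big1 => k _; case: eqP => //= ->; case: eqP.
have lt_b1 : (mdeg b1 < d)%N.
  by rewrite ltnS mdeg_mnm3 -addnA leq_addr.
rewrite (bigD1 (BMultinom lt_b1)) //= eqxx [X in _ + X]big1 ?addr0 // => k ne.
by case: eqP => // kb; case/eqP: ne; apply: val_inj.
Qed.

End Gaussian.

Theorem theorem9 (R : comAlgType rat) (n : nat) (n_gt0 : (0 < n)%N)
    (G F : 'I_n -> {mfps R[n]})
    (F_no_constant_term : forall i, F i 0%MM = 0)
    (F_implicit : forall i, F i = mfps_X R i * mfps_comp (G i) F)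
    (alpha : 'X_{1..n}) :
  let integrand : {mfps R[n + (n + n)]} :=
    (\prod_(i < n) var_u R i ^+ alpha i) * mfps_exp (ubarXG G) in
  [/\ \det (1%:M - XdG G F) \is a GRing.unit,
      gauss_integrable integrand &
      (\prod_(i < n) F i ^+ alpha i) * (\det (1%:M - XdG G F))^-1
        = gauss_int integrand].
Proof.
move=> integrand.
(* The moment forces [b1 = b2] and the integrand [b1 = b3]. For each [b3] a single pair remains,
   which gives integrability and collapses the integral to one term. *)
have intE b1 b2 b3 : (b1, b2) != (b3, b3) ->
    integrand (mnm3 b1 b2 b3) * gauss_moment R b1 b2 = 0.
  move=> ne; have [b12|/gauss_moment_neq->] := eqVneq b1 b2; last first.
    by rewrite mulr0.
  rewrite mfps_coef_gauss_integrand; case: eqP => [b13|_].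
    by rewrite -b12 -b13 eqxx in ne.
  by rewrite mul0r.
split; first exact: unit_det_XdG.
  move=> b3; apply: sub_finite_set (finite_seq [:: (b3, b3)]) => -[b1 b2] /= nz.
  by rewrite inE; apply: contra_notT nz; apply: intE.
(* The left-hand side becomes Phi of the monomial [u^alpha]. *)
rewrite -(mfps_comp_mono F_no_constant_term) mfps_diag_det //.
apply: mfpsP => b; rewrite mfps_coef_diag.
rewrite -[RHS]/(\sum_(c \in [set: _]%classic) _).
rewrite (fsbigE [:: (b, b)]) //; last first.
  by move=> [b1 b2] _; rewrite inE; apply: intE.
rewrite big_cons big_nil in_setT Monoid.mulm1 mfps_coef_gauss_integrand eqxx.
(* The moment [b!] cancels the factor [1 / b!] of the exponential. *)
rewrite gauss_moment_eq mulrAC natVK ?mul1r //.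
by rewrite -lt0n prodn_gt0 // => i; apply: fact_gt0.
Qed.
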